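(* For every real $x \in (-\sqrt{27/5},\sqrt{27/5})$, $$\cos^2\frac{x}{2} \le \frac{\sin x}{x} \le \cos^3\left(\frac{x}{3}\right) \le \frac{2+\cos x}{3}.$$
   Context: At $x=0$ the quotient $(\sin x)/x$ is taken to be its limiting value $1$. Powers such as $\cos^k y$ mean $(\cos y)^k$. *)

(* Defs.v *)
From Stdlib Require Import Reals.
Open Scope R_scope.

(* [sin x / x], extended by its limit at [x = 0]; the case split is needed
   because [/ 0] is a total but unspecified value in Stdlib. *)
Definition sinc (x : R) : R :=
  if Req_dec_T x 0 then 1 else sin x / x.

(* Main.v *)
Require Import Defs.
From Stdlib Require Import Reals.
From Stdlib Require Import Lra.
From Coquelicot Require Import Coquelicot.
Open Scope R_scope.

(** All four expressions are even in [x] and equal to [1] at [0], and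
    [sqrt (27 / 5) < 3 < PI], so only [0 < x < PI] matters.
    The half-angle and triple-angle formulas turn each inequality into an
    elementary one.

    - With [h = x / 2], [sin x / x = sin h * cos h / h], and the left inequality
      becomes [h * cos h <= sin h] ([mul_cos_le_sin]).

    - With [y = x / 3] and [t = tan y], dividing [sin (3 y) = 3 sin y - 4 sin^3 y]
      by [3 cos^3 y] gives [t (1 + t^2) - 4/3 t^3 = t - t^3 / 3].  The middle
      inequality is therefore [t - t^3 / 3 <= atan t], the truncated alternating
      Taylor series of [atan] ([atan_ge_cubic]).

    - With [c = cos (x / 3)], [cos x = 4 c^3 - 3 c], and the right inequality is
      [0 <= (c - 1)^2 (c + 2)].

    The two calculus facts hold because the difference of their sides vanishes
    at [0] and has derivative [h * sin h], respectively [t^4 / (1 + t^2)]. *)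

Lemma ge_0_of_derive_ge_0 (f f' : R -> R) (b : R) :
  0 <= b -> f 0 = 0 ->
  (forall t, 0 <= t <= b -> is_derive f t (f' t)) ->
  (forall t, 0 <= t <= b -> 0 <= f' t) ->
  0 <= f b.
Proof.
  intros [Hb | <-] H0 Hd Hpos; [|lra].
  destruct (MVT_cor2 f f' 0 b Hb) as [c [Hc Hcb]].
  { intros t Ht. apply is_derive_Reals, Hd, Ht. }
  assert (0 <= f' c) by (apply Hpos; lra).
  nra.
Qed.

Lemma mul_cos_le_sin (h : R) : 0 <= h <= PI -> h * cos h <= sin h.
Proof.
  intros Hh.
  enough (0 <= sin h - h * cos h) by lra.
  apply (ge_0_of_derive_ge_0 (fun t => sin t - t * cos t) (fun t => t * sin t));
    [lra | rewrite sin_0; ring | |].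
  - intros t _. auto_derive; [exact I | ring].
  - intros t Ht. apply Rmult_le_pos; [lra | apply sin_ge_0; lra].
Qed.

Lemma atan_ge_cubic (t : R) : 0 <= t -> t - t ^ 3 / 3 <= atan t.
Proof.
  intros Ht.
  enough (0 <= atan t - (t - t ^ 3 / 3)) by lra.
  apply (ge_0_of_derive_ge_0 (fun u => atan u - (u - u ^ 3 / 3))
           (fun u => u ^ 4 / (1 + u ^ 2)));
    [lra | rewrite atan_0; field | |].
  - intros u _. auto_derive; [exact I | field; nra].
  - intros u Hu. apply Rdiv_le_0_compat; [apply pow_le; lra | nra].
Qed.

Lemma sin_3a (y : R) : sin (3 * y) = 3 * sin y - 4 * sin y ^ 3.
Proof.
  replace (3 * y) with (2 * y + y) by ring.
  rewrite sin_plus, sin_2a, cos_2a_sin.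
  replace (2 * sin y * cos y * cos y) with (2 * sin y * (cos y)²)
    by (unfold Rsqr; ring).
  rewrite cos2. unfold Rsqr. ring.
Qed.

Lemma cos_3a (y : R) : cos (3 * y) = 4 * cos y ^ 3 - 3 * cos y.
Proof.
  replace (3 * y) with (2 * y + y) by ring.
  rewrite cos_plus, sin_2a, cos_2a_cos.
  replace (2 * sin y * cos y * sin y) with (2 * cos y * (sin y)²)
    by (unfold Rsqr; ring).
  rewrite sin2. unfold Rsqr. ring.
Qed.

Lemma cos_half_sqr_le_sin_div (x : R) :
  0 < x <= PI -> cos (x / 2) ^ 2 <= sin x / x.
Proof.
  intros Hx.
  assert (Hs := mul_cos_le_sin (x / 2) ltac:(lra)).
  assert (Hc : 0 <= cos (x / 2)) by (apply cos_ge_0; lra).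
  apply (Rle_div_r _ _ x ltac:(lra)).
  replace (sin x) with (2 * sin (x / 2) * cos (x / 2))
    by (rewrite <- sin_2a; f_equal; field).
  assert (Hm := Rmult_le_compat_r _ _ _ Hc Hs).
  nra.
Qed.

Lemma sin_div_le_cos_third_cube (x : R) :
  0 < x < 3 * (PI / 2) -> sin x / x <= cos (x / 3) ^ 3.
Proof.
  intros Hx.
  set (y := x / 3).
  assert (Hxy : x = 3 * y) by (unfold y; field).
  assert (Hy : 0 < y < PI / 2) by lra.
  assert (Hc : 0 < cos y) by (apply cos_gt_0; lra).
  assert (Ht : 0 <= tan y) by (apply Rlt_le, tan_gt_0; lra).
  assert (Ha := atan_ge_cubic (tan y) Ht).
  rewrite atan_tan in Ha by lra.
  apply (Rle_div_l _ _ x ltac:(lra)).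
  rewrite Hxy, sin_3a.
  assert (Hs : 3 * sin y - 4 * sin y ^ 3
               = 3 * cos y ^ 3 * (tan y - tan y ^ 3 / 3)).
  { assert (Hsin : sin y = tan y * cos y) by (unfold tan; field; lra).
    (* [1 = sin^2 + cos^2] makes the left side homogeneous of degree 3. *)
    assert (H1 : cos y ^ 2 = 1 - sin y ^ 2)
      by (rewrite <- !Rsqr_pow2; apply cos2).
    replace (3 * sin y - 4 * sin y ^ 3)
      with (3 * sin y * (cos y ^ 2 + sin y ^ 2) - 4 * sin y ^ 3)
      by (rewrite H1; ring).
    rewrite Hsin. field. }
  rewrite Hs.
  assert (0 < cos y ^ 3) by (apply pow_lt; lra).
  nra.
Qed.

Lemma cos_third_cube_le (x : R) : cos (x / 3) ^ 3 <= (2 + cos x) / 3.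
Proof.
  replace (cos x) with (4 * cos (x / 3) ^ 3 - 3 * cos (x / 3))
    by (rewrite <- cos_3a; f_equal; field).
  assert (Hc := COS_bound (x / 3)).
  assert (0 <= (cos (x / 3) - 1) ^ 2 * (cos (x / 3) + 2))
    by (apply Rmult_le_pos; [apply pow2_ge_0 | lra]).
  nra.
Qed.

Lemma sinc_0 : sinc 0 = 1.
Proof. unfold sinc. destruct (Req_dec_T 0 0); lra. Qed.

Lemma sinc_neq_0 (x : R) : x <> 0 -> sinc x = sin x / x.
Proof. intros Hx. unfold sinc. destruct (Req_dec_T x 0); [easy | reflexivity]. Qed.

Lemma sinc_opp (x : R) : sinc (- x) = sinc x.
Proof.
  destruct (Req_dec x 0) as [-> | Hx]; [now rewrite Ropp_0|].
  rewrite !sinc_neq_0 by lra. rewrite sin_neg. field. exact Hx.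
Qed.

Lemma sinc_bounds (x : R) :
  0 <= x <= PI -> cos (x / 2) ^ 2 <= sinc x <= cos (x / 3) ^ 3.
Proof.
  intros [[Hx | <-] Hpi].
  - rewrite sinc_neq_0 by lra. split.
    + apply cos_half_sqr_le_sin_div; lra.
    + apply sin_div_le_cos_third_cube; lra.
  - rewrite sinc_0. unfold Rdiv. rewrite !Rmult_0_l, cos_0. lra.
Qed.

Theorem theorem2p6 (x : R) (hx : - sqrt (27 / 5) < x < sqrt (27 / 5)) :
  cos (x / 2) ^ 2 <= sinc x /\
  sinc x <= cos (x / 3) ^ 3 /\
  cos (x / 3) ^ 3 <= (2 + cos x) / 3.
Proof.
  assert (Hsqrt : sqrt (27 / 5) < 3).
  { rewrite <- (sqrt_pow2 3) by lra. apply sqrt_lt_1; lra. }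
  assert (HPI := PI2_3_2).
  enough (cos (x / 2) ^ 2 <= sinc x <= cos (x / 3) ^ 3)
    by (repeat split; [lra | lra | apply cos_third_cube_le]).
  destruct (Rle_dec 0 x) as [Hx | Hx].
  - apply sinc_bounds. lra.
  - rewrite <- sinc_opp, <- (cos_neg (x / 2)), <- (cos_neg (x / 3)), <- !Rdiv_opp_l.
    apply sinc_bounds. lra.
Qed.
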